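(* For every $f\in BLO(\mathbb{R})$ define $$\sigma(f)=\inf\{\mu>0:\ e^{f/\mu}\in A_1\}.$$ Then $$dist_{BLO'}(f,L^\infty):=\inf_{h\in L^\infty(\mathbb{R})}\|f-h\|_{BLO}'=\sigma(f).$$
   Context: Functions are real valued on $\mathbb{R}$; $I$ denotes a generic compact interval of $\mathbb{R}$, $f_I=\frac1{|I|}\int_I f(x)\,dx$, and $\inf_I f$ is the essential infimum of $f$ on $I$. $BLO(\mathbb{R})$ (bounded lower oscillation) is the class of $f\in L^1_{loc}(\mathbb{R})$ such that $\|f\|_{BLO}:=\sup_I\,[f_I-\inf_I f]<\infty$; functions in $BLO$ are considered modulo constants. A weight $w:\mathbb{R}\to[0,+\infty)$, $w\in L^1_{loc}(\mathbb{R})$, belongs to the Muckenhoupt class $A_1$ if $A_1(w)=\sup_{I}\frac{\frac1{|I|}\int_I w(x)\,dx}{\inf_I w}<\infty$. For $g\in L^1_{loc}(\mathbb{R})$, the Hardy–Littlewood maximal function is $Mg(x)=\sup_{I\ni x}\frac1{|I|}\int_I|g(t)|\,dt$. For $f\in BLO(\mathbb{R})$, $$\|f\|_{BLO}'=\inf\{\alpha+\|b\|_{\infty}:\ \alpha>0,\ b\in L^\infty(\mathbb{R}) \text{ such that there exists } g\in L^1_{loc}(\mathbb{R}) \text{ with } f=\alpha\log(Mg)+b\}.$$ *)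

(* Defs.v *)
From HB Require Import structures.
From mathcomp Require Export all_boot all_order all_algebra.
From mathcomp Require Export all_classical all_reals all_analysis.
From mathcomp Require Export ess_sup_inf hoelder.
Export Order.TTheory GRing.Theory Num.Theory.
Export numFieldNormedType.Exports.

Set Implicit Arguments.
Unset Strict Implicit.
Unset Printing Implicit Defensive.

Local Open Scope classical_set_scope.
Local Open Scope ring_scope.
Local Open Scope ereal_scope.

(* Suprema and infima are taken in [\bar R], so that the infimum of an empty
   set is [+oo] and an infinite supremum is [+oo]. *)
Section blo.
Context {R : realType}.
Implicit Types f g b w : R -> R.

Local Notation mu := (@lebesgue_measure R).

Definition L1loc f := locally_integrable setT f.

Definition Linfty : set (R -> R) := [set b | b \in Lfun mu +oo].

Definition Linfty_norm b : \bar R := 'N[mu]_(+oo)[EFin \o b].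

Definition mean f (I : set R) : \bar R :=
  (mu I)^-1 * \int[mu]_(x in I) (f x)%:E.

Definition ess_inf_itv f (I : interval R) : \bar R :=
  ess_inf (mrestr mu (measurable_itv I)) (EFin \o f).

(* Only nondegenerate intervals are used, as averages need [0 < |I|]. *)
Definition BLO_norm f : \bar R :=
  ereal_sup [set y | exists u v : R, (u < v)%R /\
    y = mean f `[u, v] - ess_inf_itv f `[u, v]].

Definition BLO f := L1loc f /\ BLO_norm f < +oo.

(* [0^-1 = +oo] in [\bar R], so a nonzero mean over an essential infimum equal
   to 0 gives [+oo]; [0 / 0] is 0, which only happens when [w] vanishes a.e. on
   the interval, hence never for the exponential of a function. *)
Definition A1_const w : \bar R :=
  ereal_sup [set y | exists u v : R, (u < v)%R /\
    y = mean w `[u, v] / ess_inf_itv w `[u, v]].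

Definition A1 w :=
  [/\ forall x, (0 <= w x)%R, L1loc w & A1_const w < +oo].

(* Uncentered, unlike [HL_maximal]; [iavg] is the average of [`|g|]. *)
Definition maximal_itv g (x : R) : \bar R :=
  ereal_sup [set y | exists u v : R,
    [/\ (u < v)%R, (u <= x <= v)%R & y = iavg g `[u, v]]].

(* The equation is between extended reals: it excludes [g] for which
   [maximal_itv g] is infinite or zero on a set of positive measure. *)
Definition BLO_norm' f : \bar R :=
  ereal_inf [set y | exists (alpha : R) b,
    [/\ (0 < alpha)%R, Linfty b,
        exists2 g, L1loc g & {ae mu, forall x,
          (f x)%:E = alpha%:E * lne (maximal_itv g x) + (b x)%:E}
      & y = alpha%:E + Linfty_norm b]].

Definition sigma f : \bar R :=
  ereal_inf [set m%:E | m in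
    [set m : R | (0 < m)%R /\ A1 (fun x => expR (f x / m))]].

End blo.

(* Main.v *)
Require Import Defs.
From mathcomp Require Import ring lra measurable_realfun.
Local Open Scope classical_set_scope.
Local Open Scope ereal_scope.

(** The two inequalities come from the two halves of the Coifman-Rochberg
    description of [A1]: up to bounded factors, [A1] weights are the powers
    [(Mg)^s] with [0 < s < 1].

    [dist <= sigma].  Let [w = e^(f/m)] be in [A1].  Then [w <= Mw <= C w]
    almost everywhere: the first inequality is Lebesgue differentiation
    ([normr_le_maximal_itv]), the second is the [A1] condition applied to
    intervals with rational endpoints ([maximal_itv_A1_le]).  Taking logarithms,
    [h := f - m log(Mw)] is bounded, and [f - h = m log(Mw) + 0] is a
    representation of cost [m] ([BLO_norm'_le_of_A1]).

    [sigma <= dist].  Let [f - h = a log(Mg) + b] with [b] and [h] bounded, and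
    let [m > a].  With [W = e^(f/a)] and [s = a/m < 1] one has [e^(f/m) = W^s],
    and [W] is comparable to [Mg] because [b + h] is bounded.  Let [y] be a
    point of an interval [I] with [Mg(y)] finite and nonzero.  On [I], values of
    [Mg] above [2 Mg(y)] only come from the part of [g] in the triple of [I],
    whose integral is at most [3 |I| Mg(y)]; the weak (1,1) inequality then
    gives [|{x in I : Mg(x) > t}| <= 36 |I| Mg(y) / t] for all [t > 0]
    ([maximal_itv_weak_local]).  Under such a weak
    bound, the average of the [s]-th power over [I] is at most a multiple of
    [(Mg(y))^s] ([kolmogorov_inequality]), so the average of [W^s] over [I] is at most
    [C W(y)^s] for almost every [y] in [I], which is the [A1] condition
    ([A1_of_log_maximal]).  Hence [sigma f <= m] for every [m > a], and
    [sigma f <= a <= a + ||b||]. *)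

(** * Powers of functions satisfying a weak-type bound *)

Section kolmogorov.
Set Implicit Arguments.
Unset Strict Implicit.
Local Open Scope ring_scope.
Local Open Scope ereal_scope.
Context {R : realType}.

(** The [1] accounts for the values below the threshold of
    [kolmogorov_inequality], the quotient is the sum of the geometric series over
    the dyadic layers above it. *)
Definition kolmogorov_cst (s : R) : R :=
  (1 + 2 `^ s / (1 - 2 `^ (s - 1)))%R.

Lemma kolmogorov_cst_gt0 (s : R) : (s < 1)%R -> (0 < kolmogorov_cst s)%R.
Proof.
move=> s1; rewrite ltr_wpDr// divr_ge0 ?powR_ge0// subr_ge0.
by rewrite -[leRHS](powRr0 2) ler_powR ?ler1n// subr_le0 ltW.
Qed.

Lemma dyadic_bracket (c y : R) : (0 < c)%R -> (c < y)%R ->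
  exists k, (2 ^+ k * c < y <= 2 ^+ k.+1 * c)%R.
Proof.
move=> c0 cy.
have ex : exists n, (y <= 2 ^+ n * c)%R.
  exists (Num.truncn (y / c)).+1; rewrite -ler_pdivrMr//.
  apply: (@le_trans _ _ (Num.truncn (y / c)).+1%:R%R).
    by rewrite ltW// -truncn_lt_nat// divr_ge0// ltW// (lt_trans c0).
  by rewrite -natrX ler_nat ltnW// ltn_expl.
case: (ex_minnP ex) => -[|k] yk mink.
  by move: yk; rewrite expr0 mul1r leNgt cy.
exists k; rewrite yk andbT ltNge; apply/negP => /mink.
by rewrite ltnn.
Qed.

(** Below height [c] the integrand is at most [c^s]. Above it, the layer
    [2^k c < w <= 2^(k+1) c] has measure at most [2^-k e] and contributes at most
    [(2^(k+1) c)^s 2^-k e]; these bounds form a geometric series of ratio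
    [2^(s-1) < 1]. *)
Lemma kolmogorov_inequality d (T : measurableType d)
    (mu : {measure set T -> \bar R}) (E : set T) (w : T -> R) (e c s : R) :
  measurable E -> measurable_fun setT w -> (forall x, 0 <= w x)%R ->
  (0 <= e)%R -> mu E <= e%:E -> (0 < c)%R -> (0 < s < 1)%R ->
  (forall t : R, (0 < t)%R -> mu (E `&` [set x | t < w x]%R) <= (c * e / t)%:E) ->
  \int[mu]_(x in E) (w x `^ s)%:E <= (kolmogorov_cst s * e * c `^ s)%:E.
Proof.
move=> mE mw w0 e0 Ee c0 /andP[s0 s1] weak.
pose A k := E `&` [set x | 2 ^+ k * c < w x]%R.
have mA k : measurable (A k).
  have -> : A k = E `&` w @^-1` `]2 ^+ k * c, +oo[%classic%R.
    by rewrite preimage_itvoy.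
  by apply: (measurable_funTS mw).
pose b k : R := ((2 ^+ k.+1 * c) `^ s)%R.
have b0 k : (0 <= b k)%R by exact: powR_ge0.
have term0 k x : 0 <= (b k)%:E * (\1_(A k) x)%:E.
  by rewrite mule_ge0// lee_fin.
have mterm k : measurable_fun E (fun x => (b k)%:E * (\1_(A k) x)%:E).
  apply: measurable_funeM; apply/measurable_EFinP.
  exact: measurable_indic.
have pointwise x : E x -> (w x `^ s)%:E <=
    (c `^ s)%:E + \sum_(0 <= k <oo) (b k)%:E * (\1_(A k) x)%:E.
  move=> Ex; have [wc|cw] := leP (w x) c.
    rewrite -[leLHS]adde0; apply: leeD.
      by rewrite lee_fin ge0_ler_powR ?nnegrE// ltW.
    by apply: nneseries_ge0 => k _ _.
  have [k /andP[kw wk]] := dyadic_bracket c0 cw.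
  rewrite -[leLHS]add0e; apply: leeD; first by rewrite lee_fin powR_ge0.
  apply: le_trans (nneseries_lim_ge k.+1 (fun n _ _ => term0 n x)).
  rewrite big_nat_recr//= -[leLHS]add0e; apply: leeD.
    by apply: sume_ge0 => i _; exact: term0.
  rewrite indicE mem_set ?mule1; last by split.
  by rewrite lee_fin ge0_ler_powR ?nnegrE ?mulr_ge0 ?exprn_ge0 ?(ltW s0) ?(ltW c0).
pose q : R := (2 `^ (s - 1))%R.
have q0 : (0 < q)%R by exact: powR_gt0.
have q1 : (q < 1)%R.
  by rewrite /q /powR pnatr_eq0/= expR_lt1 pmulr_llt0 ?subr_lt0// ln_gt0// ltr1n.
have termE k : (b k * (c * e / (2 ^+ k * c)) =
    geometric (e * c `^ s * 2 `^ s) q k)%R.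
  rewrite /geometric/= /b /q powRM ?exprn_ge0 ?(ltW c0)//.
  have -> : ((2 ^+ k.+1) `^ s = 2 `^ s * (2 `^ (s - 1)) ^+ k * 2 ^+ k :> R)%R.
    rewrite -!powR_mulrn ?powR_ge0// -!powRrM -!powRD; last 2 first.
    - by rewrite pnatr_eq0 implybT.
    - by rewrite pnatr_eq0 implybT.
    by congr (_ `^ _)%R; rewrite -natr1; ring.
  by field; rewrite gt_eqF ?exprn_gt0//= gt_eqF.
apply: (@le_trans _ _ (\int[mu]_(x in E)
    ((c `^ s)%:E + \sum_(0 <= k <oo) (b k)%:E * (\1_(A k) x)%:E))).
  apply: ge0_le_integral => //.
  - by move=> x _; rewrite lee_fin powR_ge0.
  - apply: measurable_funTS; apply/measurable_EFinP.
    exact: (measurableT_comp (measurable_powR s)).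
  - apply: emeasurable_funD; first exact: measurable_cst.
    exact: (@ge0_emeasurable_sum _ _ _ _ _ xpredT).
rewrite ge0_integralD//=; last 3 first.
- by move=> x _; rewrite lee_fin powR_ge0.
- by move=> x _; apply: nneseries_ge0 => k _ _.
- exact: (@ge0_emeasurable_sum _ _ _ _ _ xpredT).
rewrite integral_cst// integral_nneseries//.
have -> : (kolmogorov_cst s * e * c `^ s =
    c `^ s * e + e * c `^ s * 2 `^ s / (1 - q))%R.
  by rewrite /kolmogorov_cst -/q; field; rewrite subr_eq0 gt_eqF.
rewrite EFinD; apply: leeD; first by rewrite EFinM lee_pmul2l ?lte_fin ?powR_gt0.
apply: lime_le.
  by apply: is_cvg_nneseries => k _ _; exact: integral_ge0.
apply: nearW => n.
apply: le_trans (_ : (series (geometric (e * c `^ s * 2 `^ s) q) n)%:E <= _); last first.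
  rewrite lee_fin geometric_le_lim ?gtr0_norm// ?mulr_ge0 ?powR_ge0//.
rewrite /series/= -sumEFin; apply: lee_sum => k _.
rewrite ge0_integralZl_EFin//; last first.
  by apply/measurable_EFinP; exact: measurable_indic.
rewrite integral_indic// setIidl; last by move=> x [].
have := termE k; rewrite /geometric/= => <-; rewrite EFinM lee_wpmul2l ?lee_fin//.
by apply: weak; rewrite mulr_gt0 ?exprn_gt0.
Qed.

End kolmogorov.

Section coifman_rochberg.
Set Implicit Arguments.
Unset Strict Implicit.
Context {R : realType}.
Implicit Types b f g h w : R -> R.
Local Notation mu := (@lebesgue_measure R).

(** * Lebesgue measure and almost-everywhere statements *)

Lemma lebesgue_measure_itvcc (u v : R) : (u <= v)%R -> mu `[u, v] = (v - u)%:E.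
Proof.
rewrite lebesgue_measure_itv/= lte_fin le_eqVlt => /predU1P[->|->].
  by rewrite ltxx subrr.
by rewrite EFinB.
Qed.

Lemma lebesgue_measure_setT_gt0 : 0 < mu [set: R].
Proof.
apply: lt_le_trans (_ : mu `[0%R, 1%R] <= _).
  by rewrite lebesgue_measure_itvcc// lte_fin subr0.
by apply: le_measure; rewrite ?inE.
Qed.

Lemma ae_impl (P Q : R -> Prop) : (forall x, P x -> Q x) ->
  {ae mu, forall x, P x} -> {ae mu, forall x, Q x}.
Proof.
move=> PQ [N [mN N0 PN]]; exists N; split => // x nQ.
by apply: PN => /PQ.
Qed.

Lemma ae_and (P Q : R -> Prop) : {ae mu, forall x, P x} ->
  {ae mu, forall x, Q x} -> {ae mu, forall x, P x /\ Q x}.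
Proof.
move=> [M [mM M0 PM]] [N [mN N0 PN]]; exists (M `|` N); split.
- exact: measurableU.
- by rewrite measureU0.
- by move=> x /not_andP[nP|nQ]; [left; exact: PM|right; exact: PN].
Qed.

(** Translates the restricted measure in which the essential infimum is taken
    into a statement about points of [D]. *)
Lemma ae_mrestrP (D : set R) (mD : measurable D) (P : R -> Prop) :
  {ae mrestr mu mD, forall x, P x} <-> {ae mu, forall x, D x -> P x}.
Proof.
split=> -[N [mN N0 PN]].
  exists (N `&` D); split => //; first exact: measurableI.
  by move=> x /= /not_implyP[Dx nPx]; split => //; apply: PN.
exists (N `|` ~` D); split.
- by apply: measurableU => //; exact: measurableC.
- rewrite /mrestr setIUl setICl setU0.
  by apply: (subset_measure0 _ mN) => //; exact: measurableI.
- move=> x /= nPx; have [Dx|] := pselect (D x); last by right.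
  by left; apply: PN => /= /(_ Dx).
Qed.

Lemma ae_itv_witness (u v : R) (P : R -> Prop) : (u < v)%R ->
  {ae mu, forall x, (u <= x <= v)%R -> P x} ->
  exists2 x, (u <= x <= v)%R & P x.
Proof.
move=> uv [N [mN N0 PN]]; apply: contrapT => nex.
have : mu `[u, v] <= mu N.
  apply: le_measure; rewrite ?inE//.
  move=> x /=; rewrite in_itv/= => uxv; apply: PN => /= H.
  by apply: nex; exists x => //; exact: H.
by rewrite N0 lebesgue_measure_itvcc ?(ltW uv)// lee_fin leNgt subr_gt0 uv.
Qed.

Lemma measure_le_ae (A B : set R) : measurable A -> measurable B ->
  {ae mu, forall x, A x -> B x} -> mu A <= mu B.
Proof.
move=> mA mB [N [mN N0 AB]]; have <- : mu (B `|` N) = mu B by rewrite measureU0.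
apply: le_measure; rewrite ?inE//; first exact: measurableU.
move=> x Ax; have [Bx|nBx] := pselect (B x); [by left|right].
by apply: AB => /= /(_ Ax).
Qed.

(** * The uncentered maximal function *)

Lemma iavg_itv g (u v : R) : (u < v)%R ->
  iavg g `[u, v] = (v - u)^-1%:E * \int[mu]_(x in `[u, v]) `|g x|%:E.
Proof.
move=> uv; rewrite /iavg lebesgue_measure_itvcc ?ltW//.
by rewrite inver subr_eq0 gt_eqF.
Qed.

Lemma iavg_itv_le g (u v m : R) : (u < v)%R ->
  (iavg g `[u, v] <= m%:E) =
  (\int[mu]_(x in `[u, v]) `|g x|%:E <= (m * (v - u))%:E).
Proof.
move=> uv; rewrite iavg_itv// lee_pdivrMl ?subr_gt0//.
by rewrite -EFinM mulrC.
Qed.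

Lemma iavg_itv_gt g (u v m : R) : (u < v)%R ->
  (m%:E < iavg g `[u, v]) =
  ((m * (v - u))%:E < \int[mu]_(x in `[u, v]) `|g x|%:E).
Proof. by move=> uv; rewrite !ltNge iavg_itv_le. Qed.

Lemma mean_itv_le f (u v m : R) : (u < v)%R ->
  (mean f `[u, v] <= m%:E) =
  (\int[mu]_(x in `[u, v]) (f x)%:E <= (m * (v - u))%:E).
Proof.
move=> uv; rewrite /mean lebesgue_measure_itvcc ?(ltW uv)//.
rewrite inver subr_eq0 gt_eqF// lee_pdivrMl ?subr_gt0//.
by rewrite -EFinM mulrC.
Qed.

Lemma L1loc_itv_lty g (u v : R) : L1loc g ->
  \int[mu]_(x in `[u, v]) `|g x|%:E < +oo.
Proof. by move=> [_ _]; apply => //; exact: segment_compact. Qed.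

Lemma integral_itv_abs_le g (u v p q : R) : measurable_fun setT g ->
  (p <= u)%R -> (v <= q)%R ->
  \int[mu]_(x in `[u, v]) `|g x|%:E <= \int[mu]_(x in `[p, q]) `|g x|%:E.
Proof.
move=> mg pu vq; apply: ge0_subset_integral => //.
- by apply: measurable_funTS; apply/measurable_EFinP; exact: measurableT_comp.
- by apply: subset_itv; rewrite bnd_simp.
Qed.

Lemma maximal_itv_ub g (u v x : R) : (u < v)%R -> (u <= x <= v)%R ->
  iavg g `[u, v] <= maximal_itv g x.
Proof. by move=> uv uxv; apply: ereal_sup_ubound => /=; exists u, v. Qed.

Lemma maximal_itv_ge0 g x : 0 <= maximal_itv g x.
Proof.
apply: le_trans (@maximal_itv_ub g x (x + 1) x _ _); first exact: iavg_ge0.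
- by rewrite ltrDl.
- by rewrite lexx/= lerDl.
Qed.

Lemma maximal_itv_leP g (m : R) x : reflect
  (forall u v : R, (u < v)%R -> (u <= x <= v)%R ->
    \int[mu]_(x in `[u, v]) `|g x|%:E <= (m * (v - u))%:E)
  (maximal_itv g x <= m%:E).
Proof.
apply: (iffP idP) => [Mm u v uv uxv|H].
  rewrite -iavg_itv_le//; apply: le_trans Mm; exact: maximal_itv_ub.
by apply: ge_ereal_sup => _ [u [v [uv uxv ->]]]; rewrite iavg_itv_le// H.
Qed.

Lemma maximal_itv_gt g (m : R) x : m%:E < maximal_itv g x ->
  exists u v : R, [/\ (u < v)%R, (u <= x <= v)%R &
    (m * (v - u))%:E < \int[mu]_(x in `[u, v]) `|g x|%:E].
Proof.
move=> /ereal_sup_gt[_ [u [v [uv uxv ->]]]]; rewrite iavg_itv_gt// => H.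
by exists u, v.
Qed.

(** If the average over an interval through [x] exceeds [a], so does the average
    over a slightly larger interval, which contains all points near [x]. *)
Lemma lower_semicontinuous_maximal_itv g : L1loc g ->
  lower_semicontinuous (maximal_itv g).
Proof.
move=> lg x a /maximal_itv_gt[u [v [uv /andP[ux xv]]]].
have Ifin : \int[mu]_(x in `[u, v]) `|g x|%:E \is a fin_num.
  by rewrite ge0_fin_numE ?L1loc_itv_lty ?integral_ge0.
rewrite -(fineK Ifin); set s := fine _; rewrite lte_fin => as_.
(* Widening the interval by d on each side costs 2ad < s - a(v - u). *)
pose d := ((s - a * (v - u)) / (4 * (`|a| + 1)))%R.
have a1 : (0 < 4 * (`|a| + 1))%R by rewrite mulr_gt0// ltr_wpDl.
have d0 : (0 < d)%R by rewrite divr_gt0// subr_gt0.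
have dE : (d * (4 * (`|a| + 1)) = s - a * (v - u))%R.
  by rewrite /d divfK// gt_eqF.
exists (ball x d); first exact: nbhsx_ballx.
move=> y; rewrite /ball/= ltr_distlC => /andP[xy yx].
have uvd : (u - d < v + d)%R by lra.
apply: lt_le_trans (@maximal_itv_ub _ (u - d) (v + d) _ _ _) => //; last first.
  by apply/andP; split; lra.
rewrite iavg_itv_gt//; apply: (@lt_le_trans _ _ s%:E); last first.
  rewrite fineK//; apply: integral_itv_abs_le; [by case: lg|lra|lra].
have ad : (a * d <= `|a| * d)%R by rewrite ler_wpM2r ?(ltW d0)// ler_norm.
have ad0 : (0 <= `|a| * d)%R by rewrite mulr_ge0// (ltW d0).
rewrite lte_fin; nra.
Qed.

Lemma measurable_maximal_itv g : L1loc g ->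
  measurable_fun setT (maximal_itv g).
Proof.
move=> lg; apply: lower_semicontinuous_measurable.
exact: lower_semicontinuous_maximal_itv.
Qed.

(** An interval through [x] of length [l] sits in the ball of radius [2 l]
    around [x], which is four times as long. *)
Lemma maximal_itv_le_HL g x : measurable_fun setT g ->
  maximal_itv g x <= 4%:E * HL_maximal g x.
Proof.
move=> mg; apply: ge_ereal_sup => _ [u [v [uv /andP[ux xv] ->]]].
have vu0 : (0 < v - u)%R by rewrite subr_gt0.
apply: (@le_trans _ _ (4%:E * iavg g (ball x (2 * (v - u))%R))); last first.
  rewrite lee_pmul2l//; apply: ereal_sup_ubound.
  by exists (2 * (v - u))%R => //=; rewrite in_itv/= andbT mulr_gt0.
rewrite iavg_itv// /iavg lebesgue_measure_ball; last by rewrite mulr_ge0 ?ltW.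
rewrite inver gt_eqF; last by rewrite mulrn_wgt0// mulr_gt0.
rewrite muleA -EFinM.
have -> : (4 / (2 * (v - u) *+ 2) = (v - u)^-1)%R.
  by rewrite -mulr_natr; field; rewrite gt_eqF.
rewrite lee_pmul2l ?lte_fin ?invr_gt0//.
apply: ge0_subset_integral => //; first exact: measurable_ball.
- apply: measurable_funTS; do 2 apply: measurableT_comp => //.
- move=> z /=; rewrite in_itv/= => /andP[uz zv].
  by rewrite /ball/= ltr_distlC; apply/andP; split; lra.
Qed.

(** Among the intervals that meet `[u, v], only those contained in its triple [J]
    can give averages above [2m]: an interval that meets `[u, v] and leaves [J] is at least as long as
    `[u, v], so it extends to an interval through [y] at most twice as long, whose
    average is at most [m]. Hence [g] may be replaced by its restriction to [J],
    of integral at most [3 (v - u) m], in the weak (1,1) inequality. For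
    [t < 2m] the bound exceeds the length of `[u, v]. The constant is
    [36 = 3 * 4 * 3]: weak (1,1) constant, passage from centered to uncentered
    averages, and length of [J]. *)
Lemma maximal_itv_weak_local g (u v y m t : R) : L1loc g ->
  (u < v)%R -> (u <= y <= v)%R -> maximal_itv g y <= m%:E ->
  (0 < m)%R -> (0 < t)%R ->
  mu (`[u, v] `&` [set x | t%:E < maximal_itv g x]) <= (36 * m * (v - u) / t)%:E.
Proof.
move=> lg uv /andP[uy yv] /maximal_itv_leP Mm m0 t0.
have mg : measurable_fun setT g by case: lg.
have mlevel h (s : R) : L1loc h -> measurable [set x | s%:E < maximal_itv h x].
  move=> lh; rewrite -[X in measurable X]setTI.
  apply: emeasurable_fun_o_infty => //; exact: measurable_maximal_itv.
have vu0 : (0 < v - u)%R by rewrite subr_gt0.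
have [t2|mt] := ltP t (2 * m)%R.
  apply: (@le_trans _ _ (v - u)%:E).
    rewrite -lebesgue_measure_itvcc ?(ltW uv)//; apply: le_measure.
    - by rewrite inE; apply: measurableI => //; exact: mlevel.
    - by rewrite inE.
    - exact: subIsetl.
  by rewrite lee_fin ler_pdivlMr//; nra.
pose J : set R := `[(2 * u - v)%R, (2 * v - u)%R].
have mJ : measurable J by exact: measurable_itv.
have intJ : mu.-integrable J (EFin \o g).
  apply/integrableP; split.
    by apply: measurable_funTS; exact/measurable_EFinP.
  exact: L1loc_itv_lty.
have lg1 : locally_integrable setT (g \_ J).
  exact: integrable_locally_restrict.
have sub : [set x | t%:E < maximal_itv g x] `&` `[u, v] `<=`
    [set x | (t / 4)%:E < HL_maximal (g \_ J) x].
  move=> x [/= /maximal_itv_gt[a [b [ab /andP[ax xb] tab]]]].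
  rewrite in_itv/= => /andP[ux xv].
  have [aJ bJ] : (2 * u - v <= a)%R /\ (b <= 2 * v - u)%R.
    apply/andP; apply: contraLR tab; rewrite negb_and -!ltNge => ab_out.
    rewrite -leNgt.
    have ba : (v - u <= b - a)%R by move: ab_out => /orP[]; lra.
    have [m1 m2] : (Num.min a u <= a /\ Num.min a u <= u)%R.
      by rewrite !ge_min !lexx orbT.
    have [m3 m4] : (b <= Num.max b v /\ v <= Num.max b v)%R.
      by rewrite !le_max !lexx orbT.
    have m5 : (Num.max b v - Num.min a u <= 2 * (b - a))%R.
      by case: (leP b v) => ?; case: (leP a u) => ?; lra.
    apply: le_trans (integral_itv_abs_le mg m1 m3) _.
    apply: le_trans (Mm _ _ _ _) _; first lra.
      by apply/andP; split; lra.
    by rewrite lee_fin; nra.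
  have : t%:E < maximal_itv (g \_ J) x.
    apply: lt_le_trans (maximal_itv_ub _ ab _); last by rewrite ax xb.
    rewrite iavg_itv_gt//; move: tab; congr (_ < _); apply: eq_integral => z.
    rewrite inE/= in_itv/= => /andP[az zb]; rewrite patchE mem_set//.
    by rewrite /J/= in_itv/=; apply/andP; split; lra.
  move=> /lt_le_trans /(_ (maximal_itv_le_HL x _)) H.
  rewrite mulrC EFinM lte_pdivrMl//.
  by apply: H; case: lg1.
have t40 : (0 < t / 4)%R by rewrite divr_gt0.
rewrite setIC; apply: (@le_trans _ _ (mu [set x | (t / 4)%:E < HL_maximal (g \_ J) x])).
  apply: le_measure; rewrite ?inE//.
  - by apply: measurableI => //; exact: mlevel.
  - rewrite -[X in measurable X]setTI; apply: emeasurable_fun_o_infty => //.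
    exact: measurable_HL_maximal.
apply: le_trans (maximal_inequality lg1 t40) _.
have -> : \int[mu]_(z in setT) `|((g \_ J) z)%:E| = \int[mu]_(z in J) `|g z|%:E.
  rewrite [RHS]integral_mkcond; apply: eq_integral => z _.
  by rewrite /= restrict_EFin/= restrict_normr.
have -> : (36 * m * (v - u) / t = 3 / (t / 4) * (m * ((2 * v - u) - (2 * u - v))))%R.
  by field; rewrite gt_eqF.
rewrite [leRHS]EFinM lee_pmul2l//; last by rewrite lte_fin divr_gt0.
by apply: Mm; [lra|apply/andP; split; lra].
Qed.

(** * The A1 condition at almost every point *)

Lemma le_ess_inf_itv w (u v : R) (y : \bar R) :
  y <= ess_inf_itv w `[u, v]%R <->
  {ae mu, forall x, (u <= x <= v)%R -> y <= (w x)%:E}.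
Proof.
rewrite /ess_inf_itv; split.
  move=> /ess_infP/ae_mrestrP; apply: ae_impl => x H uxv.
  by apply: H; rewrite /= in_itv.
move=> H0; apply/ess_infP/ae_mrestrP; apply: (ae_impl _ H0) => x H.
by rewrite /= in_itv/=; exact: H.
Qed.

(** Together with [A1_ae_bound], this replaces the quotient by an essential
    infimum, with its conventions for [0] and [+oo], by an inequality at almost
    every point. Local integrability is part of the conclusion: the bound at
    a single point [y] of a large interval shows that the integral is finite. *)
Lemma A1_of_ae_bound w (C : R) : measurable_fun setT w ->
  (forall x, 0 < w x)%R -> (0 <= C)%R ->
  (forall u v : R, (u < v)%R -> {ae mu, forall y, (u <= y <= v)%R ->
    \int[mu]_(x in `[u, v]) (w x)%:E <= (C * w y * (v - u))%:E}) ->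
  A1 w.
Proof.
move=> mw w0 C0 H; split; first by move=> x; exact: ltW.
  split=> [//||K _ cK]; first exact: openT.
  have [M [_ KM]] := compact_bounded cK.
  pose A : R := (`|M| + 1)%R.
  have A0 : (0 < A)%R by rewrite ltr_wpDl.
  have NA : (- A < A)%R by lra.
  have [y _ Hy] := ae_itv_witness NA (H _ _ NA).
  apply: le_lt_trans (ltry (C * w y * (A - - A))); apply: le_trans Hy.
  under eq_integral do rewrite ger0_norm ?ltW//.
  apply: ge0_subset_integral => //=.
  - exact: compact_measurable.
  - by apply: measurable_funTS; exact/measurable_EFinP.
  - by move=> x _; rewrite lee_fin ltW.
  - move=> x Kx; rewrite /= in_itv/= -ler_norml; apply: KM => //.
    by rewrite /A ltr_pwDr// ler_norm.
apply: le_lt_trans (ltry C); apply: ge_ereal_sup => _ [u [v [uv ->]]].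
have [y uyv Hy] := ae_itv_witness uv (H _ _ uv).
have m0 : 0 <= mean w `[u, v].
  rewrite /mean mule_ge0// ?inve_ge0// integral_ge0// => x _.
  by rewrite lee_fin ltW.
have mfin : mean w `[u, v] \is a fin_num.
  rewrite ge0_fin_numE//; apply: le_lt_trans (ltry (C * w y)).
  by rewrite mean_itv_le.
pose a := fine (mean w `[u, v]).
have aE : mean w `[u, v] = a%:E by rewrite fineK.
rewrite aE; have [->|an0] := eqVneq a 0%R; first by rewrite mul0e lee_fin.
have a0 : (0 < a)%R by rewrite lt0r an0 fine_ge0.
have Cw0 : (0 < C)%R.
  rewrite lt0r C0 andbT; apply/eqP => C00.
  by move: Hy; rewrite -mean_itv_le// aE C00 mul0r lee_fin leNgt a0.
(* The mean a satisfies a <= C w almost everywhere on the interval. *)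
have ess : (a / C)%:E <= ess_inf_itv w `[u, v]%R.
  apply/le_ess_inf_itv; apply: (ae_impl _ (H _ _ uv)) => x Hx /Hx.
  by rewrite -mean_itv_le// aE !lee_fin ler_pdivrMr// mulrC.
move: ess; case: (ess_inf_itv _ _) => [e| |//].
  rewrite lee_fin => ace; have e0 : (0 < e)%R.
    by apply: lt_le_trans ace; rewrite divr_gt0.
  rewrite inver gt_eqF// -EFinM lee_fin ler_pdivrMr//.
  by move: ace; rewrite ler_pdivrMr// mulrC.
by rewrite invey mule0 lee_fin.
Qed.

Lemma A1_ae_bound w : A1 w -> (forall x, 0 < w x)%R ->
  exists2 C : R, (0 < C)%R &
  forall u v : R, (u < v)%R -> {ae mu, forall y, (u <= y <= v)%R ->
    \int[mu]_(x in `[u, v]) (w x)%:E <= (C * w y * (v - u))%:E}.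
Proof.
move=> [_ lw]; set A := A1_const w => Aoo w0.
exists (`|fine A| + 1)%R; first by rewrite ltr_wpDl.
move=> u v uv; have /le_ess_inf_itv := lexx (ess_inf_itv w `[u, v]%R).
apply: ae_impl => y ey uyv; rewrite -mean_itv_le//.
have aA : mean w `[u, v] / ess_inf_itv w `[u, v]%R <= A.
  by apply: ereal_sup_ubound; exists u, v.
have m0 : 0 <= mean w `[u, v].
  rewrite /mean mule_ge0// ?inve_ge0// integral_ge0// => x _.
  by rewrite lee_fin ltW.
move: (ey uyv) aA => {ey}; set e := ess_inf_itv _ _ => ew aA.
have e0 : 0 <= e by apply/le_ess_inf_itv; apply: aeW => x _; rewrite lee_fin ltW.
have efin : e \is a fin_num by rewrite ge0_fin_numE// (le_lt_trans ew)// ltry.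
have Afin : A \is a fin_num.
  rewrite ge0_fin_numE//; apply: le_trans aA.
  by rewrite mule_ge0// inve_ge0.
move: ew aA e0; rewrite -(fineK efin) -(fineK Afin).
set r := fine e; set B := fine A; rewrite !lee_fin => rw aB r0.
have BB : (B <= `|B| + 1)%R by rewrite ler_wpDr// ler_norm.
have [r00|rn0] := eqVneq r 0%R.
  have [->|mn0] := eqVneq (mean w `[u, v]) 0.
    by rewrite lee_fin mulr_ge0 ?(ltW (w0 y))// addr_ge0.
  move: aB; rewrite r00 inve0 gt0_muley ?leye_eq//.
  by rewrite lt0e mn0.
have rgt0 : (0 < r)%R by rewrite lt0r rn0.
move: aB; rewrite inver (negbTE rn0) lee_pdivrMr// => /le_trans; apply.
rewrite -EFinM lee_fin (le_trans (ler_wpM2r r0 BB))//.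
by rewrite ler_wpM2l// addr_ge0.
Qed.

(** The exceptional null set of the [A1] bound depends on the interval, so the
    bound is first obtained for all rational intervals at once. A real interval
    through [x] is contained in a rational one at most twice as long, which
    costs the factor [2]. *)
Lemma maximal_itv_A1_le w : A1 w -> (forall x, 0 < w x)%R ->
  exists2 C : R, (0 < C)%R &
    {ae mu, forall x, maximal_itv w x <= (C * w x)%:E}.
Proof.
move=> Aw w0; have [C C0 HC] := A1_ae_bound Aw w0.
have mw : measurable_fun setT w by case: Aw => _ [].
exists (2 * C)%R; first by rewrite mulr_gt0.
pose P n x := forall p q : rat, unpickle n = Some (p, q) ->
  (ratr p < ratr q :> R)%R -> (ratr p <= x <= ratr q)%R ->
  \int[mu]_(y in `[ratr p, ratr q]) (w y)%:E <= (C * w x * (ratr q - ratr p))%:E.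
have aeP : {ae mu, forall x, forall n, P n x}.
  apply: ae_foralln => n; rewrite /P.
  case: (unpickle n) => [[p q]|]; last by apply: aeW.
  have [pq|pq] := boolP (ratr p < ratr q :> R)%R; last first.
    by apply: aeW => x p' q' [<- <-]; rewrite (negbTE pq).
  by apply: (ae_impl _ (HC _ _ pq)) => x Hx p' q' [<- <-].
apply: (ae_impl _ aeP) => x Px; apply/maximal_itv_leP => u v uv /andP[ux xv].
have lu : (u - (v - u) / 2 < u)%R by lra.
have lv : (v < v + (v - u) / 2)%R by lra.
have [p] := rat_in_itvoo lu; rewrite in_itv/= => /andP[up pu].
have [q] := rat_in_itvoo lv; rewrite in_itv/= => /andP[vq qv].
apply: le_trans (integral_itv_abs_le mw (ltW pu) (ltW vq)) _.
under eq_integral do rewrite ger0_norm ?(ltW (w0 _))//.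
apply: le_trans (Px (pickle (p, q)) p q _ _ _) _.
- by rewrite pickleK.
- by lra.
- by apply/andP; split; lra.
rewrite lee_fin (_ : 2 * C * w x * (v - u) = C * w x * (2 * (v - u)))%R; last by ring.
by rewrite ler_wpM2l ?mulr_ge0 ?ltW//; lra.
Qed.

(** At a Lebesgue point, [|g x|] is at most the average of [|g|] over
    the ball of radius [r] plus the mean deviation of [g] from [g x] there, and
    the latter tends to [0] with [r]. *)
Lemma normr_le_maximal_itv g : L1loc g ->
  {ae mu, forall x, `|g x|%:E <= maximal_itv g x}.
Proof.
move=> lg; have mg : measurable_fun setT g by case: lg.
apply: (ae_impl _ (lebesgue_differentiation lg)) => x gx.
rewrite leNgt; apply/negP => Mlt.
have Mfin : maximal_itv g x \is a fin_num.
  by rewrite ge0_fin_numE ?maximal_itv_ge0// (lt_trans Mlt) ?ltry.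
move: Mlt; rewrite -(fineK Mfin) lte_fin; set m := fine _ => mg_lt.
have gap0 : 0 < (`|g x| - m)%:E by rewrite lte_fin subr_gt0.
have near_small : \forall r \near 0^'+%R, davg g x r < (`|g x| - m)%:E.
  exact: gx (open_ereal_lt' gap0).
near (0%R : R)^'+ => r.
have r0 : (0 < r)%R by [].
have small : davg g x r < (`|g x| - m)%:E by near: r.
have rr : (x - r < x + r)%R by lra.
pose B : set R := ball x r.
have mB : measurable B by exact: measurable_ball.
have muB : mu B = (r *+ 2)%:E by rewrite /B lebesgue_measure_ball// ltW.
have r20 : (0 < r *+ 2)%R by rewrite mulrn_wgt0.
have avg_le : iavg g B <= m%:E.
  rewrite /m fineK//.
  apply: le_trans (maximal_itv_ub _ rr _); last by apply/andP; split; lra.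
  rewrite iavg_itv// /iavg muB inver gt_eqF//.
  have -> : (x + r - (x - r) = r *+ 2)%R by rewrite -mulr_natr; ring.
  rewrite lee_pmul2l ?lte_fin ?invr_gt0//; apply: ge0_subset_integral => //.
  - by apply: measurable_funTS; do 2 apply: measurableT_comp => //.
  - move=> z; rewrite /B /ball/= in_itv/= ltr_distlC => /andP[? ?].
    by apply/andP; split; lra.
have avg_cst : iavg (g \+ (fun y => g x - g y))%R B = `|g x|%:E.
  rewrite /iavg (_ : \int[mu]_(y in B) _ = \int[mu]_(y in B) cst `|g x|%:E y); last first.
    by apply: eq_integral => y _ /=; congr (`|_|%:E); ring.
  rewrite integral_cst// -[X in _ * (_ * X)]/(mu B) muB inver gt_eqF// -!EFinM; congr EFin.
  by field; rewrite gt_eqF.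
have avg_diff : iavg (fun y => g x - g y)%R B = davg g x r.
  rewrite /davg /iavg; congr (_ * _); apply: eq_integral => y _.
  by rewrite /= distrC.
have := @iavgD _ g (fun y => g x - g y)%R B mB.
rewrite muB ltry avg_cst avg_diff => /(_ isT) H.
have : `|g x|%:E <= iavg g B + davg g x r.
  apply: H; first exact: measurable_funTS.
  by apply: measurable_funB => //; exact: measurable_funTS.
apply/negP; rewrite -ltNge (_ : `|g x| = m + (`|g x| - m))%R; last by ring.
rewrite EFinD; apply: lee_ltD => //.
rewrite ge0_fin_numE ?iavg_ge0//; exact: le_lt_trans avg_le (ltry _).
Unshelve. all: by end_near. Qed.

(** * Representations by logarithms of maximal functions *)

Lemma LinftyP b : Linfty b <->
  measurable_fun setT b /\ exists K : R, {ae mu, forall x, (`|b x| <= K)%R}.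
Proof.
rewrite /Linfty/=; split.
  move=> /andP[]; rewrite !inE/= /finite_norm unlock lebesgue_measure_setT_gt0.
  move=> mb bK; split => //.
  have bK' : ess_sup mu (EFin \o (Num.norm \o b)) < +oo by exact: bK.
  have [K HK] := ess_supr_bounded bK'.
  by exists K; apply: (ae_impl _ HK).
move=> [mb [K bK]]; apply/andP; rewrite !inE/=; split => //.
rewrite /finite_norm unlock lebesgue_measure_setT_gt0.
apply: le_lt_trans (ltry K); apply/ess_supP.
by apply: (ae_impl _ bK) => x bx /=; rewrite lee_fin.
Qed.

Lemma LinftyD b h : Linfty b -> Linfty h -> Linfty (b \+ h)%R.
Proof.
move=> /LinftyP[mb [K bK]] /LinftyP[mh [L hL]]; apply/LinftyP; split.
  exact: measurable_funD.
exists (K + L)%R; apply: (ae_impl _ (ae_and bK hL)) => x [bx hx].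
by rewrite (le_trans (ler_normD _ _))// lerD.
Qed.

(** The weight serves as its own [g]: [w] and [Mw] are comparable, so
    [h = f - m log(Mw)] is bounded and [f - h] is exactly [m log(Mw)]. *)
Lemma BLO_norm'_le_of_A1 f (m : R) : measurable_fun setT f -> (0 < m)%R ->
  A1 (fun x => expR (f x / m)) ->
  exists2 h, Linfty h & BLO_norm' (f \- h)%R <= m%:E.
Proof.
move=> mf m0 Aw; set w := (fun x => _) in Aw.
have w0 x : (0 < w x)%R by exact: expR_gt0.
have lw : L1loc w by case: Aw.
have [C C0 MC] := maximal_itv_A1_le Aw w0.
have aeM := ae_and MC (normr_le_maximal_itv lw).
pose Mw x := fine (maximal_itv w x).
have MwE x : maximal_itv w x <= (C * w x)%:E -> maximal_itv w x = (Mw x)%:E.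
  move=> H; rewrite fineK// ge0_fin_numE ?maximal_itv_ge0//.
  exact: le_lt_trans H (ltry _).
pose h x := (f x - m * ln (Mw x))%R.
exists h.
  apply/LinftyP; split.
    apply: measurable_funB => //; apply: measurable_funM => //.
    apply: measurableT_comp; first exact: measurable_ln.
    by apply: measurableT_comp => //; exact: measurable_maximal_itv.
  exists (m * ln C)%R; apply: (ae_impl _ aeM) => x [xC xw].
  have Mx := MwE _ xC; move: xC xw; rewrite Mx !lee_fin ger0_norm ?(ltW (w0 x))// => MC' wM.
  have M0 : (0 < Mw x)%R by exact: lt_le_trans wM.
  have fE : (f x = m * ln (w x))%R by rewrite /w expRK mulrC divfK// gt_eqF.
  have l1 : (ln (w x) <= ln (Mw x))%R by rewrite ler_ln ?posrE.
  have l2 : (ln (Mw x) <= ln C + ln (w x))%R.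
    by rewrite -lnM ?posrE// ler_ln ?posrE ?mulr_gt0.
  rewrite ler_norml /h fE; apply/andP; split; nra.
apply: ereal_inf_lbound; exists m, (cst 0%R); split => //.
- by apply/LinftyP; split => //; exists 0%R; apply: aeW => x; rewrite normr0.
- exists w => //; apply: (ae_impl _ aeM) => x [xC xw].
  move: xw; rewrite MwE// lee_fin ger0_norm ?(ltW (w0 x))// => wM.
  rewrite lne_EFin ?(lt_le_trans (w0 x))// adde0 -EFinM /h/=.
  by congr EFin; ring.
- by rewrite /Linfty_norm (_ : EFin \o _ = cst 0)// Lnorm0// adde0.
Qed.

(** Since the left-hand side is a real number, the equation forces
    [0 < M < +oo]; exponentiating it gives the comparison. *)
Lemma log_maximal_bounds (a b f K : R) (M : \bar R) : (0 < a)%R ->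
  (`|b| <= K)%R -> f%:E = a%:E * lne M + b%:E ->
  [/\ (0 < fine M)%R, M = (fine M)%:E,
      (expR (f / a) <= expR (K / a) * fine M)%R &
      (fine M <= expR (K / a) * expR (f / a))%R].
Proof.
move=> a0; rewrite ler_norml => /andP[Kb bK].
case: M => [r| |]/=; last 2 first.
- by rewrite gt0_muley ?lte_fin.
- by rewrite gt0_muleNy ?lte_fin.
case: ifPn => [r0|]; first by rewrite gt0_muleNy ?lte_fin.
rewrite -ltNge => r0 [fE].
have rE : r = expR ((f - b) / a).
  by rewrite fE addrK mulrAC divff ?gt_eqF// mul1r lnK.
split => //; rewrite rE -expRD ler_expR -mulrDl ler_wpM2r ?invr_ge0 ?(ltW a0)//; lra.
Qed.

(** [e^(f/m)] is the power [a/m < 1] of [W = e^(f/a)], and [W] inherits the local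
    weak bound of [Mg] up to the factor [k^2], where [k] compares [W] with [Mg]. *)
Lemma A1_of_log_maximal f g b (a m : R) : measurable_fun setT f -> L1loc g ->
  Linfty b -> (0 < a < m)%R ->
  {ae mu, forall x, (f x)%:E = a%:E * lne (maximal_itv g x) + (b x)%:E} ->
  A1 (fun x => expR (f x / m)).
Proof.
move=> mf lg /LinftyP[_ [K bK]] /andP[a0 am] fE.
have m0 : (0 < m)%R by exact: lt_trans am.
pose W x := expR (f x / a); pose k := expR (K / a); pose s := (a / m)%R.
have k0 : (0 < k)%R by exact: expR_gt0.
have W0 x : (0 < W x)%R by exact: expR_gt0.
have s01 : (0 < s < 1)%R by rewrite divr_gt0//= ltr_pdivrMr// mul1r.
have WsE x : expR (f x / m) = (W x `^ s)%R.
  by rewrite /W -expRM /s; congr expR; field; rewrite !gt_eqF.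
have mW : measurable_fun setT W.
  by apply: measurableT_comp => //; exact: measurable_funM.
have mM := measurable_maximal_itv lg.
have bounds : {ae mu, forall x, [/\ (0 < fine (maximal_itv g x))%R,
    maximal_itv g x = (fine (maximal_itv g x))%:E,
    (W x <= k * fine (maximal_itv g x))%R &
    (fine (maximal_itv g x) <= k * W x)%R]}.
  apply: (ae_impl _ (ae_and bK fE)) => x [bx fx].
  exact: log_maximal_bounds fx.
have mlevel (t : R) : measurable [set x | t%:E < maximal_itv g x].
  by rewrite -[X in measurable X]setTI; exact: emeasurable_fun_o_infty.
pose C := (kolmogorov_cst s * (36 * k ^+ 2) `^ s)%R.
apply: (@A1_of_ae_bound _ C).
- by apply: measurableT_comp => //; exact: measurable_funM.
- by move=> x; exact: expR_gt0.
- rewrite mulr_ge0 ?powR_ge0// ltW// kolmogorov_cst_gt0//.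
  by case/andP: s01.
move=> u v uv; apply: (ae_impl _ bounds) => y [M0 My _ MW] uyv.
have vu0 : (0 < v - u)%R by rewrite subr_gt0.
pose c := (36 * k ^+ 2 * W y)%R.
have c0 : (0 < c)%R by rewrite !mulr_gt0// exprn_gt0.
under eq_integral do rewrite WsE.
apply: le_trans (@kolmogorov_inequality _ _ _ mu `[u, v] W (v - u) c s _ _ _ _ _ c0 s01 _) _ => //.
- by move=> x; exact: ltW.
- exact: ltW.
- by rewrite -lebesgue_measure_itvcc ?(ltW uv).
- move=> t t0; have tk0 : (0 < t / k)%R by rewrite divr_gt0.
  apply: (@le_trans _ _ (mu (`[u, v] `&` [set x | (t / k)%:E < maximal_itv g x]))).
    apply: measure_le_ae.
    + apply: measurableI => //; rewrite -preimage_itvoy -[X in measurable X]setTI.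
      exact: mW.
    + exact: measurableI.
    + apply: (ae_impl _ bounds) => x [_ Mx WM _] [/= xuv tW]; split => //=.
      by rewrite Mx lte_fin ltr_pdivrMr// mulrC (lt_le_trans tW).
  apply: le_trans (maximal_itv_weak_local lg uv uyv _ M0 tk0) _.
    by rewrite -My.
  rewrite lee_fin /c; set p := fine _.
  rewrite (_ : 36 * p * (v - u) / (t / k) = 36 * (k * p) * (v - u) / t)%R; last first.
    by field; rewrite !gt_eqF.
  by rewrite ler_pM2r ?invr_gt0// ler_pM2r// expr2 -!mulrA !ler_pM2l.
rewrite lee_fin /c /C WsE [in leLHS]powRM ?(ltW (W0 y)) ?mulr_ge0 ?exprn_ge0 ?(ltW k0)//.
by rewrite le_eqVlt; apply/orP; left; apply/eqP; ring.
Qed.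

End coifman_rochberg.

Theorem theorem8 (R : realType) (f : R -> R) (hf : BLO f) :
  ereal_inf [set BLO_norm' (f \- h)%R | h in Linfty] = sigma f.
Proof.
have mf : measurable_fun setT f by case: hf => -[].
apply/eqP; rewrite eq_le; apply/andP; split.
  apply: le_ereal_inf_tmp => _ [m [m0 Am] <-].
  have [h hL hm] := BLO_norm'_le_of_A1 mf m0 Am.
  by apply: le_trans hm; apply: ereal_inf_lbound; exists h.
apply: le_ereal_inf_tmp => _ [h hL <-].
apply: le_ereal_inf_tmp => _ [a [b [a0 bL [g lg fE] ->]]].
apply: (@le_trans _ _ a%:E); last by rewrite leeDl// Lnorm_ge0.
apply/lee_addgt0Pr => e e0; rewrite -EFinD; apply: ereal_inf_lbound.
exists (a + e)%R => //; split; first exact: addr_gt0.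
have am : (0 < a < a + e)%R by rewrite a0 ltrDl.
apply: (A1_of_log_maximal mf lg (LinftyD bL hL) am).
apply: (ae_impl _ fE) => x fx.
by rewrite EFinD addeA -fx -EFinD subrK.
Qed.
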